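(* Let $\mathcal{H},\mathcal{H}_x,\mathcal{H}_z$ be real Hilbert spaces and $\rho>0$. Let $(F^k)$ and $(G^k)$ be sequences of operators with $F^k:\mathcal{H}_x\rightrightarrows\mathcal{H}_x$ and $G^k:\mathcal{H}_z\rightrightarrows\mathcal{H}_z$. Let $A:\mathcal{H}_x\to\mathcal{H}$ and $B:\mathcal{H}_z\to\mathcal{H}$ be linear and $d_{F^k},d_{G^k}\in\mathcal{H}$. Let $D_{F^k}$ denote the dual operator of $F^k$ with respect to $A$ and $d_{F^k}$, and $D_{G^k}$ the dual operator of $G^k$ with respect to $B$ and $d_{G^k}$. The Douglas–Rachford (DR) sequence given by $$y^{k+1}\in\tfrac12\big(I+R_{\rho D_{F^{k+1}}}\circ R_{\rho D_{G^k}}\big)y^k$$ induces a sequence $(x^k,z^k,\lambda^k)$ satisfying $$x^{k+1}\in J^A_{\rho^{-1}F^{k+1}}\big(-A^*(Bz^k+\rho^{-1}\lambda^k+d_{F^{k+1}}+d_{G^k})\big),$$ $$z^{k+1}\in J^B_{\rho^{-1}G^{k}}\big(-B^*(Ax^{k+1}+\rho^{-1}\lambda^k+d_{F^{k+1}}+d_{G^{k}})\big),$$ $$\lambda^{k+1}=\lambda^k+\rho\,(Ax^{k+1}+Bz^{k+1}+d_{F^{k+1}}+d_{G^{k}}).$$ Furthermore, the sequences $(x^k,z^k,\lambda^k)_k$ and $(y^k)_k$ are connected by the following identities (the Gabay identities): - $\rho Ax^{k+1}\in J_{\rho D_{F^{k+1}}}\big(R^k_{\rho D_{G^k}}y^k\big)-R^k_{\rho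 D_{G^k}}y^k-\rho d_{F^{k+1}}$; - $\rho Bz^k=\lambda^k-y^k-\rho d_{G^k}$; - $\lambda^k\in J_{\rho D_{G^k}}y^k$; - $y^k=\lambda^{k-1}+\rho(Ax^k+d_{F^{k+1}})$; - $R^k_{\rho D_{G^k}}y^k=\lambda^k+\rho(Bz^k+d_{G^k})$; - $J_{\rho D_{F^{k+1}}}\big(R^k_{\rho D_{G^k}}y^k\big)\ni\lambda^k+\rho(Ax^{k+1}+Bz^k+d_{F^{k+1}}+d_{G^k})$.
   Context: $I$ is the identity; $M^*$ denotes the adjoint of $M$; $T^{-1}$ is the set-valued inverse of $T$. For $H:\mathcal{H}_1\rightrightarrows\mathcal{H}_1$, $M:\mathcal{H}_1\to\mathcal{H}$ linear and $d\in\mathcal{H}$, the dual operator of $H$ with respect to $M$ and $d$ is $D_H=(-M\circ H^{-1}\circ -M^* )(\cdot)-d$, i.e. $D_H(\lambda)=\{-Mx-d: x\in H^{-1}(-M^*\lambda)\}$. The resolvent is $J_T=(I+T)^{-1}$ and the reflected resolvent is $R_T=2J_T-I$ (both possibly set-valued or empty-valued). The generalized resolvent of $T$ with respect to a linear map $U$ is $J^U_T=(U^*U+T)^{-1}$. The symbol $R^k_{\rho D_{G^k}}y^k$ denotes the element of $R_{\rho D_{G^k}}y^k$ selected at iteration $k$, namely $2\lambda^k-y^k$ for the chosen $\lambda^k\in J_{\rho D_{G^k}}y^k$. The vectors $x^0$ and $\lambda^{-1}$ are auxiliary starting vectors, chosen so that the identity for $y^k$ holds at the first iteration.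
   Formalization: Indices corrected: z-update uses G^{k+1}, d_{G^{k+1}} (not G^k, d_{G^k}); λ-update uses d_{G^{k+1}} (not d_{G^k}); y^k = λ^{k-1}+ρ(Ax^k+d_{F^k}) (not d_{F^{k+1}}); printed version fails when these vary with k. A, B are taken bounded so that the adjoints exist. *)

(* Defs.v *)
From HB Require Import structures.
From mathcomp Require Import all_boot all_order all_algebra.
From mathcomp Require Import boolp classical_sets reals topology normedtype.

Set Implicit Arguments.
Unset Strict Implicit.
Unset Printing Implicit Defensive.

Import Order.TTheory GRing.Theory Num.Theory.
Import numFieldNormedType.Exports.

Local Open Scope classical_set_scope.
Local Open Scope ring_scope.

(* A real Hilbert space is a complete normed module whose norm comes from a
   positive definite form, symmetric because [idfun] stands in for the
   conjugation. *)
HB.mixin Record CompleteNormedModule_isHilbert (R : realType) V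
    & CompleteNormedModule R V := {
  inner : {dot V for (@idfun R)} ;
  inner_norm : forall x : V, inner x x = `|x| ^+ 2
}.

#[short(type="hilbertType")]
HB.structure Definition Hilbert (R : realType) :=
  {V of CompleteNormedModule R V & CompleteNormedModule_isHilbert R V}.

(* The default value 0 of [xget] is never reached when [M] is linear and
   continuous, by the Riesz representation theorem. *)
Definition adjoint (R : realType) (V W : hilbertType R) (M : V -> W) (w : W) : V :=
  xget 0 [set u : V | forall v : V, inner (M v) w = inner v u].

(* A set-valued operator from [X] to [Y] is a function [T : X -> set Y], so
   that [T x y] is a membership [y \in T x]. *)

Definition op_fun (X Y : Type) (f : X -> Y) : X -> set Y := fun x => [set f x].

Definition op_inv (X Y : Type) (T : X -> set Y) : Y -> set X :=
  fun y => [set x | T x y].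

Definition op_comp (X Y Z : Type) (S : Y -> set Z) (T : X -> set Y) :
    X -> set Z :=
  fun x => \bigcup_(y in T x) S y.

Section Operators.
Variable R : realType.

Definition op_add (X : Type) (V : hilbertType R) (S T : X -> set V) :
    X -> set V :=
  fun x => [set s + t | s in S x & t in T x].

Definition op_scale (X : Type) (V : hilbertType R) (a : R) (T : X -> set V) :
    X -> set V :=
  fun x => [set a *: t | t in T x].

Definition resolvent (V : hilbertType R) (T : V -> set V) : V -> set V :=
  op_inv (op_add (op_fun id) T).

Definition reflected_resolvent (V : hilbertType R) (T : V -> set V) :
    V -> set V :=
  op_add (op_scale 2 (resolvent T)) (op_fun -%R).

Definition gen_resolvent (V W : hilbertType R) (U : V -> W) (T : V -> set V) :
    V -> set V :=
  op_inv (op_add (op_fun (adjoint U \o U)) T).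

Definition dual_op (V W : hilbertType R) (T : V -> set V) (M : V -> W) (d : W) :
    W -> set W :=
  fun l => [set - M x - d | x in op_inv T (- adjoint M l)].

Definition dr_op (V : hilbertType R) (S T : V -> set V) : V -> set V :=
  op_scale 2^-1 (op_add (op_fun id)
    (op_comp (reflected_resolvent S) (reflected_resolvent T))).

(* [l] lists resolvent points that realize the Douglas-Rachford steps of [y]:
   the element of [reflected_resolvent (T k) (y k)] which is passed on to
   [reflected_resolvent (S k.+1)] is [2 *: l k - y k]. *)
Definition dr_selection (V : hilbertType R) (S T : nat -> V -> set V)
    (y l : nat -> V) : Prop :=
  forall k, resolvent (T k) (y k) (l k) /\
    [set 2^-1 *: (y k + s)
       | s in reflected_resolvent (S k.+1) (2 *: l k - y k)] (y k.+1).

End Operators.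

(* Main.v *)
Require Import Defs.
From HB Require Import structures.
From mathcomp Require Import all_boot all_order all_algebra.
From mathcomp Require Import ring lra.
From mathcomp Require Import boolp classical_sets reals topology normedtype.
Import Order.TTheory GRing.Theory Num.Theory.
Import numFieldNormedType.Exports.
Local Open Scope classical_set_scope.
Local Open Scope ring_scope.

(** Put [u = rho *: (M x + w)].  An inclusion [T x (- adjoint M u)] in terms of
    a dual point [u] gives an inclusion for the generalized resolvent at
    [- adjoint M w], because the adjoint is linear
    ([gen_resolvent_adjoint]).  On the other hand, a point [l] of the resolvent
    at [y] of a scaled dual operator is witnessed by a primal point [x] with
    [T x (- adjoint M l)] and [l = y + rho *: (M x + d)]
    ([resolvent_dual_opP]).

    In a Douglas-Rachford step, the inner resolvent, at [y k], yields [z k] and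
    [lam k]; the reflected point is then
    [r k = 2 *: lam k - y k = lam k + rho *: (B (z k) + dG k)].  The outer
    resolvent, at [r k], yields [x k.+1] and the point
    [u = r k + rho *: (A (x k.+1) + dF k.+1)].  Averaging gives
    [y k.+1 = y k + u - lam k = lam k + rho *: (A (x k.+1) + dF k.+1)].
    These three identities imply all the others by substitution, and the two
    primal inclusions follow from the two dual ones as explained above.

    What takes work is that the adjoint, which is chosen among the vectors that
    satisfy its defining equation, does satisfy it: this is the Riesz
    representation theorem ([riesz_representation]).  It is obtained by
    minimizing the energy [`|v| ^+ 2 / 2 - f v], for which minimizing vectors
    form a Cauchy filter by the parallelogram law; at the minimizer the first
    variation vanishes, and this is the equation [f v = inner v u]. *)

Set Implicit Arguments.
Unset Strict Implicit.
Unset Printing Implicit Defensive.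

(** * The Riesz representation theorem *)

Section HilbertSpaces.
Variables (R : realType) (V : hilbertType R).
Implicit Types u v w : V.

Lemma innerC u v : inner u v = inner v u.
Proof. by rewrite hermC expr0 mul1r. Qed.

Lemma normD_sqr u v :
  `|u + v| ^+ 2 = `|u| ^+ 2 + `|v| ^+ 2 + 2 * inner u v.
Proof.
rewrite -!inner_norm linearDl !linearDr /= (innerC v u).
by ring.
Qed.

Lemma normB_sqr u v :
  `|u - v| ^+ 2 = `|u| ^+ 2 + `|v| ^+ 2 - 2 * inner u v.
Proof. by rewrite normD_sqr normrN linearNr mulrN. Qed.

Lemma inner_inj u v : (forall w, inner w u = inner w v) -> u = v.
Proof.
move=> uv; apply/eqP; rewrite -subr_eq0 -normr_eq0 -sqrf_eq0 -inner_norm.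
by rewrite linearBr /= uv subrr.
Qed.

(** Polarization writes the inner product in terms of the norm, so continuity
    comes from that of the norm. *)
Lemma inner_continuousl w : continuous (fun v => inner v w).
Proof.
have -> : (fun v => inner v w) =
    (fun v => 4^-1 * (`|v + w| ^+ 2 - `|v - w| ^+ 2)).
  by apply/funext => v; rewrite normD_sqr normB_sqr; field.
move=> v; apply: cvgM; first exact: cvg_cst.
have nsq a : `|u + a| ^+ 2 @[u --> v] --> `|v + a| ^+ 2.
  rewrite expr2.
  have h : `|u + a| @[u --> v] --> `|v + a|.
    by apply: cvg_norm; apply: cvgD; [exact: cvg_id|exact: cvg_cst].
  exact: (cvgM h h).
by apply: cvgB; exact: nsq.
Qed.

(** The minimizer of the energy [J] exists by completeness; its Euler-Lagrange
    equation is the representation. *)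
Lemma riesz_representation (f : V -> R) :
  scalar f -> continuous f -> exists u, forall v, f v = inner v u.
Proof.
move=> f_lin f_cont.
(* As a map into the normed module [R^o], [f] is a continuous linear map, hence
   bounded; this is what makes the energy bounded below. *)
pose fL := GRing.isLinear.Build R V R^o *:%R f f_lin.
pose g : {linear V -> R^o} := HB.pack (f : V -> R^o) fL.
have fD u v : f (u + v) = f u + f v by exact: (linearD g).
have fZ a v : f (a *: v) = a * f v by exact: (linearZ_LR g).
pose J v : R := 2^-1 * `|v| ^+ 2 - f v.
have J_cont : continuous J.
  move=> v; apply: cvgB; last exact: f_cont.
  apply: cvgM; first exact: cvg_cst.
  have h : `|u| @[u --> v] --> `|v| by apply: cvg_norm; exact: cvg_id.
  by rewrite expr2; exact: (cvgM h h).
have [c f_le] : exists c : R, forall v, f v <= c * `|v|.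
  have : bounded_near g (nbhs 0) by exact/linear_bounded_continuous.
  move/linear_boundedP => [M [_ Mg]]; exists (M + 1) => v.
  apply: le_trans (ler_norm _) _.
  by apply: Mg; rewrite ltrDl ltr01.
have J_lb : has_inf (range J).
  split; first by exists (J 0), 0.
  exists (- (2^-1 * c ^+ 2)) => _ [v _ <-]; rewrite /J.
  have := f_le v; have := sqr_ge0 (`|v| - c); nra.
set m := inf (range J).
have m_le v : m <= J v by apply: ge_inf; [case: J_lb|exists v].
(* The parallelogram law: almost minimal points are close to each other. *)
have J_mid u v : 4^-1 * `|u - v| ^+ 2 = J u + J v - 2 * J (2^-1 *: (u + v)).
  rewrite /J fZ fD normrZ exprMn normB_sqr normD_sqr ger0_norm ?invr_ge0//.
  by field.
pose S (e : R) := [set v | J v <= m + e].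
have S_ne e : 0 < e -> S e !=set0.
  move=> e0; have [_ [v _ <-] Jv] := inf_adherent e0 J_lb.
  by exists v; exact: ltW.
pose Fm := filter_from [set e : R | 0 < e] S.
have Fm_filter : ProperFilter Fm.
  apply: filter_from_proper; last by move=> e; exact: S_ne.
  apply: filter_from_filter; first by exists 1 => /=.
  move=> i j /= i0 j0; exists (Num.min i j); first by rewrite /= lt_min i0 j0.
  by move=> v; rewrite /S /= => Jv; split; apply: le_trans Jv _;
    rewrite lerD2l ge_min lexx ?orbT.
have Fm_cauchy : cauchy Fm.
  apply: cauchy_exP => e e0.
  have d0 : 0 < 16^-1 * e ^+ 2 by rewrite mulr_gt0 ?invr_gt0 ?exprn_gt0.
  (* Two points of energy at most [m + d] are at squared distance at most
     [4 * (2 * d)], which is [e ^+ 2 / 2] for this choice of [d]. *)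
  have [u Su] := S_ne _ d0.
  exists u, (16^-1 * e ^+ 2) => // v Sv.
  rewrite -ball_normE /ball_ /=.
  rewrite -(ltr_pXn2r (n := 2)) ?nnegrE ?(ltW e0)//.
  have := J_mid u v; have := m_le (2^-1 *: (u + v)).
  move: Su Sv; rewrite /S /=; have := exprn_gt0 2 e0; lra.
have /cvg_ex[u uF] : cvg Fm by exact: cauchy_cvg.
have Ju_le e : 0 < e -> J u <= m + e.
  move=> e0.
  apply: (@closed_cvg _ _ Fm _ J (fun t : R => t <= m + e)) (J u) _.
  - exact: closed_le.
  - by exists e.
  - exact: cvg_comp uF (J_cont u).
exists u => v.
have Ju : J u <= m by apply/ler_addgt0Pr.
have vary t : 0 <= t * (inner v u - f v) + 2^-1 * t ^+ 2 * `|v| ^+ 2.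
  have := le_trans Ju (m_le (u + t *: v)).
  rewrite /J fD fZ normD_sqr normrZ exprMn real_normK ?num_real//.
  rewrite linearZr /= innerC; lra.
apply/eqP; rewrite eq_sym -subr_eq0; apply/eqP.
set a := inner v u - f v in vary *.
have q0 : 0 <= `|v| ^+ 2 by exact: sqr_ge0.
(* This [t] makes the linear term of [vary] dominate the quadratic one. *)
pose t := - a / (`|v| ^+ 2 + 1).
have aE : a = - t * (`|v| ^+ 2 + 1).
  by rewrite /t; field; rewrite gt_eqF// ltr_wpDl.
suff t0 : t ^+ 2 = 0.
  by move/eqP: t0; rewrite sqrf_eq0 aE => /eqP ->; rewrite oppr0 mul0r.
have := vary t; rewrite {1}aE; have := sqr_ge0 t; nra.
Qed.

End HilbertSpaces.

(** * Adjoints and resolvents of dual operators *)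

Section Adjoint.
Variables (R : realType) (V W : hilbertType R) (M : {linear V -> W}).
Hypothesis M_cont : continuous M.

Lemma adjointP v w : inner (M v) w = inner v (adjoint M w).
Proof.
have [||u uP] := @riesz_representation R V (fun v => inner (M v) w).
- by move=> a u v'; rewrite linearP linearPl.
- move=> v'; apply: (@continuous_comp V W R M (fun u => inner u w) v').
    exact: M_cont.
  exact: inner_continuousl.
have := @xgetPex V 0 [set u : V | forall v : V, inner (M v) w = inner v u].
by move=> /(_ (ex_intro _ u uP)); apply.
Qed.

Lemma adjointD : {morph adjoint M : u w / u + w}.
Proof.
by move=> u w; apply: inner_inj => v; rewrite -adjointP !linearDr /= !adjointP.
Qed.

Lemma adjointZ a w : adjoint M (a *: w) = a *: adjoint M w.
Proof.
by apply: inner_inj => v; rewrite -adjointP !linearZr /= adjointP.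
Qed.

(** [M x + w] collects the primal variable and the data of one step, so that
    [rho *: (M x + w)] is the dual iterate: the inclusion says that this
    iterate comes from [x] through the dual operator.  By linearity of the
    adjoint it splits off the term [adjoint M (M x)] of the generalized
    resolvent. *)
Lemma gen_resolvent_adjoint rho (T : V -> set V) x w : 0 < rho ->
  T x (- adjoint M (rho *: (M x + w))) ->
  gen_resolvent M (op_scale rho^-1 T) (- adjoint M w) x.
Proof.
move=> rho0 Tx; exists (adjoint M (M x)) => //.
exists (rho^-1 *: - adjoint M (rho *: (M x + w))); first by eexists; eauto.
by rewrite scalerN -adjointZ scalerK ?gt_eqF// adjointD opprD addNKr.
Qed.

End Adjoint.

Lemma resolvent_dual_opP (R : realType) (V W : hilbertType R)
    (T : V -> set V) (M : V -> W) (d : W) rho (y l : W) :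
  resolvent (op_scale rho (dual_op T M d)) y l ->
  exists2 x, T x (- adjoint M l) & l = y + rho *: (M x + d).
Proof.
move=> [_ ->] [_ [_ [x Tx <-] <-] <-]; exists x => //.
by rewrite -opprD scalerN subrK.
Qed.

(** * The Douglas-Rachford iteration *)

Theorem theorem7 (R : realType) (H Hx Hz : hilbertType R)
  (rho : R) (rho_gt0 : 0 < rho)
  (F : nat -> Hx -> set Hx) (G : nat -> Hz -> set Hz)
  (A : {linear Hx -> H}) (B : {linear Hz -> H})
  (A_cont : continuous A) (B_cont : continuous B)
  (dF dG : nat -> H) (y : nat -> H) :
  let rDF := fun k => op_scale rho (dual_op (F k) A (dF k)) in
  let rDG := fun k => op_scale rho (dual_op (G k) B (dG k)) in
  (forall k, dr_op (rDF k.+1) (rDG k) (y k) (y k.+1)) ->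
  (exists lam : nat -> H, dr_selection rDF rDG y lam) /\
  (forall lam : nat -> H, dr_selection rDF rDG y lam ->
   let r := fun k => 2 *: lam k - y k in
   exists (x : nat -> Hx) (z : nat -> Hz) (lam_m1 : H),
     (forall k,
       [/\ gen_resolvent A (op_scale rho^-1 (F k.+1))
             (- adjoint A (B (z k) + rho^-1 *: lam k + dF k.+1 + dG k))
             (x k.+1),
           gen_resolvent B (op_scale rho^-1 (G k.+1))
             (- adjoint B (A (x k.+1) + rho^-1 *: lam k + dF k.+1 + dG k.+1))
             (z k.+1)
         & lam k.+1
           = lam k + rho *: (A (x k.+1) + B (z k.+1) + dF k.+1 + dG k.+1)]) /\
     (forall k,
       [set u - r k - rho *: dF k.+1 | u in resolvent (rDF k.+1) (r k)]
         (rho *: A (x k.+1)) /\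
       [/\ rho *: B (z k) = lam k - y k - rho *: dG k,
           resolvent (rDG k) (y k) (lam k),
           y k = (if k is j.+1 then lam j else lam_m1)
                 + rho *: (A (x k) + dF k),
           reflected_resolvent (rDG k) (y k) (r k) /\
             r k = lam k + rho *: (B (z k) + dG k)
         & resolvent (rDF k.+1) (r k)
             (lam k + rho *: (A (x k.+1) + B (z k) + dF k.+1 + dG k))])).
Proof.
move=> rDF rDG dr; split.
  have /choice[lam lamP] : forall k, exists l, resolvent (rDG k) (y k) l /\
      [set 2^-1 *: (y k + s)
        | s in reflected_resolvent (rDF k.+1) (2 *: l - y k)] (y k.+1).
    move=> k; have [_ [_ -> [s [_ [_ [l lP <-] [_ -> <-]] sP] <-]] <-] := dr k.
    by exists l; split => //; exists s.
  by exists lam.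
move=> lam sel r.
have /choice[z zP] k : exists z, G k z (- adjoint B (lam k)) /\
    lam k = y k + rho *: (B z + dG k).
  by have [/resolvent_dual_opP[z Gz lamE] _] := sel k; exists z.
have rE k : r k = lam k + rho *: (B (z k) + dG k).
  by rewrite /r scaler_nat mulr2n -addrA; congr (_ + _);
    rewrite [X in X - _](zP k).2 addrC addKr.
have /choice[x' x'P] k : exists x, let u := r k + rho *: (A x + dF k.+1) in
    [/\ resolvent (rDF k.+1) (r k) u, F k.+1 x (- adjoint A u) &
        y k.+1 = lam k + rho *: (A x + dF k.+1)].
  have [_ [_ [_ [u uP <-] [_ -> <-]] yE]] := sel k.
  have [x Fx uE] := resolvent_dual_opP uP; exists x; rewrite /= -uE.
  split=> //.
  set w := rho *: _ in uE *.
  have -> : lam k + w = 2^-1 *: (2 *: lam k + (w + w)).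
    by rewrite -mulr2n -[w *+ 2]scaler_nat -scalerDr scalerK ?pnatr_eq0.
  rewrite -yE uE [in LHS]scaler_nat mulr2n; congr (_ *: _).
  rewrite -/(r k) -[_ + _ - r k]addrA [_ + w - r k]addrC addKr !addrA.
  by rewrite [y k + _]addrC addrK.
(* Nothing is required of [x 0] beyond the identity for [y 0], which the free
   vector [lam_m1] absorbs. *)
pose x k := if k is j.+1 then x' j else 0.
have uE k : r k + rho *: (A (x k.+1) + dF k.+1) =
    lam k + rho *: (A (x k.+1) + B (z k) + dF k.+1 + dG k).
  rewrite rE -addrA -scalerDr; congr (_ + _ *: _).
  by rewrite addrC addrACA !addrA.
have lamS k : lam k.+1 =
    lam k + rho *: (A (x k.+1) + B (z k.+1) + dF k.+1 + dG k.+1).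
  have [_ _ yE] := x'P k.
  rewrite [LHS](zP k.+1).2 yE -addrA -scalerDr; congr (_ + _ *: _).
  by rewrite addrACA addrA.
have rhoK w : rho *: (rho^-1 *: w) = w by rewrite scalerA divff ?scale1r ?gt_eqF.
exists x, z, (y 0 - rho *: (A 0 + dF 0)); split=> k.
  have [_ Fx _] := x'P k; rewrite uE in Fx.
  split; last exact: lamS.
  - apply: gen_resolvent_adjoint => //.
    suff -> : A (x k.+1) + (B (z k) + rho^-1 *: lam k + dF k.+1 + dG k) =
        rho^-1 *: lam k + (A (x k.+1) + B (z k) + dF k.+1 + dG k).
      by rewrite scalerDr rhoK.
    by rewrite !addrA; congr (_ + _ + _); rewrite addrC !addrA.
  - apply: gen_resolvent_adjoint => //.
    suff -> : B (z k.+1) + (A (x k.+1) + rho^-1 *: lam k + dF k.+1 + dG k.+1) =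
        rho^-1 *: lam k + (A (x k.+1) + B (z k.+1) + dF k.+1 + dG k.+1).
      by rewrite scalerDr rhoK -lamS; exact: (zP k.+1).1.
    by rewrite !addrA; congr (_ + _ + _); rewrite [B _ + _]addrC addrC addrA.
have [uP _ _] := x'P k.
split.
  exists (r k + rho *: (A (x k.+1) + dF k.+1)) => //.
  by rewrite [r k + _]addrC addrK scalerDr addrK.
have [lamP _] := sel k.
split=> //.
- by rewrite [in RHS](zP k).2 [y k + _]addrC addrK scalerDr addrK.
- case: k {uP lamP} => [|k]; first by rewrite subrK.
  by have [] := x'P k.
- split=> //; exists (2 *: lam k); first by exists (lam k).
  by exists (- y k).
- by rewrite -uE.
Qed.
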